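(* Let $\Gamma$ be a finite connected graph and let $G\le \mathrm{Aut}(\Gamma)$. Then $\Gamma$ is $(G,3)$-CH if and only if $G$ is transitive on the vertices of $\Gamma$ and, for a vertex $u$ of $\Gamma$, either $G_u^{\Gamma(u)}$ is $2$-transitive, or $G_u^{\Gamma(u)}$ is of rank $3$ and the girth of $\Gamma$ is $3$.
   Context: All groups and graphs are finite; graphs are connected, simple and undirected. For a positive integer $k$, a connected graph $\Gamma$ and $G\le\mathrm{Aut}(\Gamma)$, $\Gamma$ is $(G,k)$-connected-homogeneous (a $(G,k)$-CH graph) if each isomorphism between any two isomorphic connected induced subgraphs of $\Gamma$ of order at most $k$ extends to an automorphism $g$ of $\Gamma$ with $g\in G$. $\Gamma(u)$ denotes the set of neighbours of $u$; $G_u$ is the stabiliser of $u$, and $G_u^{\Gamma(u)}$ is the permutation group induced by $G_u$ on $\Gamma(u)$. The rank of a transitive permutation group $X$ on $\Omega$ is the number of orbits of $X$ on $\Omega\times\Omega$ (equivalently, of a point stabiliser on $\Omega$).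
   Formalization: The rank 3, girth 3 alternative additionally requires Γ not to be complete, since the printed claim fails for K_4 with G = A_4 (local group C_3 of rank 3, girth 3, not (G,3)-CH); a group on at most one point counts as 2-transitive. *)

(* Defs.v *)
From HB Require Import structures.
From mathcomp Require Import all_boot all_fingroup all_solvable.

Set Implicit Arguments.
Unset Strict Implicit.
Unset Printing Implicit Defensive.

Section Graphs.

Variable T : finType.
Implicit Types (e : rel T) (A B : {set T}).

Definition simple_graph e : Prop := symmetric e /\ irreflexive e.

Definition connected_graph e : Prop := forall x y, connect e x y.

(* The rank 3 alternative must exclude complete graphs: for K_4 with G = A_4,
   G is vertex-transitive, the vertex stabiliser induces a cyclic group of
   order 3, of rank 3, on the neighbours, and the girth is 3, but swapping two
   vertices of a triangle and fixing the third does not extend to an element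
   of G. *)
Definition complete_graph e : Prop := forall x y, x != y -> e x y.

Definition neighbours e u : {set T} := [set v | e u v].

(* The bound on the size matters: a pair of adjacent vertices is a [ucycle]. *)
Definition graph_cycle e (c : seq T) : bool := (2 < size c) && ucycleb e c.

Definition has_girth e n : Prop :=
  (exists2 c, graph_cycle e c & size c = n) /\
  (forall c, graph_cycle e c -> n <= size c).

Definition induced e A : rel T := [rel x y | [&& x \in A, y \in A & e x y]].

Definition connected_in e A : Prop :=
  A != set0 /\ {in A &, forall x y, connect (induced e A) x y}.

(* Only the values of [f] on [A] matter. *)
Definition induced_iso e A B (f : T -> T) : Prop :=
  [/\ f @: A = B, {in A &, injective f}
    & {in A &, forall x y, e (f x) (f y) = e x y}].

Definition graph_aut e : {set {perm T}} :=
  [set s : {perm T} | [forall x, forall y, e (s x) (s y) == e x y]].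

Lemma graph_aut_group_set e : group_set (graph_aut e).
Proof.
apply/group_setP; split=> [|s t].
  by rewrite inE; apply/forallP=> x; apply/forallP=> y; rewrite !perm1.
rewrite !inE => /forallP es /forallP et.
apply/forallP=> x; apply/forallP=> y; rewrite !permM.
by rewrite (eqP (forallP (et _) _)) (eqP (forallP (es _) _)).
Qed.

Canonical graph_aut_group e := Group (graph_aut_group_set e).

Definition connected_homogeneous e (G : {group {perm T}}) (k : nat) : Prop :=
  forall (A B : {set T}) (f : T -> T),
    connected_in e A -> connected_in e B -> #|A| <= k ->
    induced_iso e A B f ->
    exists2 g : {perm T}, g \in G & {in A, f =1 g}.

Definition local_group e (G : {group {perm T}}) u : {group {perm T}} :=
  (restr_perm (neighbours e u) @* 'C_G[u | 'P])%G.

(* On at most one point 2-transitivity holds vacuously, whereas the library's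
   [transitive^2] is false there (it asks for at least one pair of distinct
   points); the difference matters for the complete graphs of order 1 and 2. *)
Definition two_transitive (X : {group {perm T}}) (S : {set T}) : bool :=
  (#|S| <= 1) || [transitive^2 X, on S | 'P].

Definition perm_rank (X : {group {perm T}}) (S : {set T}) : nat :=
  #|orbit ('P * 2) X @: [set t : 2.-tuple T | t \subset S]|.

Definition transitive_of_rank (X : {group {perm T}}) (S : {set T}) n : bool :=
  [transitive X, on S | 'P] && (perm_rank X S == n).

End Graphs.

(* Main.v *)
Require Import Defs.
From mathcomp Require Import all_boot all_fingroup all_solvable.

Set Implicit Arguments.
Unset Strict Implicit.
Unset Printing Implicit Defensive.

(** Why the theorem holds.  A connected induced subgraph on at most three
    vertices is either a single vertex [c] or has a vertex [c] adjacent to all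
    its other vertices.  An isomorphism between two such subgraphs can be
    split: a vertex-transitive [G] carries the centre of the first to the centre
    of the second, and what remains is to move at most two neighbours of a
    vertex to prescribed ones by an element fixing that vertex.  So 3-CH
    amounts to vertex-transitivity together with [locally_homogeneous]: the
    stabiliser of [u] carries a pair of neighbours of [u] to any other pair
    which agrees with it on the two questions a graph isomorphism can see, are
    the entries equal and are they adjacent ([CH3_transitive],
    [CH3_locally_homogeneous], [locally_homogeneous_CH3]).

    The rest is about the local group alone.  These two questions give a
    function on pairs of neighbours, [pair_class], which is constant on the
    orbits of the local group, and local homogeneity says that it separates
    the orbits, that is, that there are no more orbits than values
    ([card_orbits_eqP]).  Two adjacent vertices are distinct, so there are at
    most three values: equal, adjacent, distinct and nonadjacent.  If [u] lies
    in a triangle and has two distinct nonadjacent neighbours, all three occur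
    and local homogeneity is rank 3 ([rank3_locally_homogeneous]).  Otherwise
    all pairs of distinct neighbours look alike and local homogeneity is
    2-transitivity ([two_transitive_locally_homogeneous],
    [locally_homogeneous_two_transitive]).  For a connected graph with a
    vertex-transitive group, the condition that [u] lies in a triangle is
    girth 3, and the condition that [u] has two distinct nonadjacent
    neighbours is incompleteness, because a connected graph all of whose neighbourhoods are
    cliques is complete ([clique_neighbours_complete]). *)

(** * Orbits and invariants *)

(** An invariant [h] maps the set of orbits onto the set of its values, so
    the two sets have the same size exactly when this map is injective.  The
    map is realised on orbits as the image under [h], which is a singleton. *)
Lemma card_orbits_eqP (aT : finGroupType) (rT I : finType)
    (to : {action aT &-> rT}) (X : {group aT}) (D : {set rT}) (h : rT -> I)
    (h_inv : forall a x, a \in X -> x \in D -> h (to x a) = h x) :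
  reflect {in D &, forall x y, h x = h y -> y \in orbit to X x}
          (#|orbit to X @: D| == #|h @: D|).
Proof.
have h_orbit x : x \in D -> h @: orbit to X x = [set h x].
  move=> Dx; apply/setP=> i; rewrite inE; apply/imsetP/eqP.
    case=> _ /orbitP[a Xa <-] ->; exact: h_inv.
  by move=> ->; exists x; rewrite ?orbit_refl.
have <-: #|(fun O : {set rT} => h @: O) @: (orbit to X @: D)| = #|h @: D|.
  rewrite -imset_comp -(card_imset (h @: D) set1_inj) -imset_comp.
  by congr #|pred_of_set _|; apply: eq_in_imset => x /h_orbit.
rewrite eq_sym; apply: (iffP imset_injP) => [inj_h x y Dx Dy hxy | compl].
  by rewrite orbit_sym; apply/orbit_eqP/inj_h; rewrite ?imset_f ?h_orbit ?hxy.
move=> _ _ /imsetP[x Dx ->] /imsetP[y Dy ->].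
rewrite !h_orbit // => /set1_inj hxy.
by apply/esym/orbit_eqP; apply: compl.
Qed.

Lemma acts_transitive (aT : finGroupType) (rT : finType)
    (to : {action aT &-> rT}) (X : {group aT}) (S : {set rT}) :
    [acts X, on S | to] -> S != set0 ->
    {in S &, forall x y, y \in orbit to X x} ->
  [transitive X, on S | to].
Proof.
move=> actX /set0Pn[x Sx] orbX; apply/imsetP; exists x => //; apply/eqP.
by rewrite eq_sym eqEsubset acts_sub_orbit // Sx; apply/subsetP=> y /(orbX x)->.
Qed.

Section Graphs.

Variables (T : finType) (e : rel T).
Implicit Types (G X : {group {perm T}}) (A B S : {set T}) (u v w : T).

(** * Pairs as 2-tuples *)

Lemma tuple2E (t : 2.-tuple T) : exists v w, t = [tuple v; w].
Proof.
case/tupleP: t => v t; case/tupleP: t => w t; exists v, w.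
by apply: val_inj; rewrite [t]tuple0.
Qed.

Lemma pair_subset v w S : ([tuple v; w] \subset S) = (v \in S) && (w \in S).
Proof. by rewrite subset_all /= andbT. Qed.

Lemma dtuple2E v w S :
  ([tuple v; w] \in 2.-dtuple(S)) = [&& v != w, v \in S & w \in S].
Proof. by rewrite !inE memtE subset_all /= mem_seq1 !andbT. Qed.

Lemma n_act_pair v w (g : {perm T}) :
  n_act 'P [tuple v; w] g = [tuple g v; g w].
Proof. exact: val_inj. Qed.

(** * Local homogeneity *)

(** Everything that an isomorphism fixing a common neighbour [u] of the two
    entries preserves: it is the isomorphism type of the subgraph induced on
    [u] and the pair, with its labelling. *)
Definition pair_class (t : 2.-tuple T) : bool * bool :=
  (tnth t ord0 == tnth t ord_max, e (tnth t ord0) (tnth t ord_max)).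

Lemma pair_classE v w : pair_class [tuple v; w] = (v == w, e v w).
Proof. by []. Qed.

(** Degenerate pairs [v = w] are included, so transitivity on the neighbours
    is part of this condition. *)
Definition locally_homogeneous G u : Prop :=
  forall v w v' w', e u v -> e u w -> e u v' -> e u w' ->
    (v == w) = (v' == w') -> e v w = e v' w' ->
  exists g : {perm T}, [/\ g \in G, g u = u, g v = v' & g w = w'].

(** Decidable forms of the two properties of [u] which decide how many classes
    of pairs of neighbours there are. *)
Definition in_triangle u : bool :=
  [exists v, exists w, [&& e u v, e u w & e v w]].

Definition open_pair u : bool :=
  [exists v, exists w, [&& e u v, e u w, v != w & ~~ e v w]].

Lemma in_triangleP u :
  reflect (exists v w, [/\ e u v, e u w & e v w]) (in_triangle u).
Proof.
apply: (iffP existsP) => -[v].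
  by case/existsP=> w /and3P; exists v, w.
by case=> w /and3P uvw; exists v; apply/existsP; exists w.
Qed.

Lemma open_pairP u :
  reflect (exists v w, [/\ e u v, e u w, v != w & ~~ e v w]) (open_pair u).
Proof.
apply: (iffP existsP) => -[v].
  by case/existsP=> w /and4P; exists v, w.
by case=> w /and4P uvw; exists v; apply/existsP; exists w.
Qed.

Lemma autE G g : G \subset graph_aut e -> g \in G -> {mono g : v w / e v w}.
Proof.
move=> /subsetP sGA /sGA; rewrite inE => /forallP aut_g v w.
exact: eqP (forallP (aut_g v) w).
Qed.

Lemma aut_norm_neighbours G u g :
    G \subset graph_aut e -> g \in G -> g u = u ->
  g \in 'N(neighbours e u | 'P)%g.
Proof.
move=> sGA Gg gu; apply/astabsP=> v.
by rewrite !inE /= apermE -{1}gu (autE sGA Gg).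
Qed.

(** * The local group *)

Lemma local_groupP G u x :
    x \in local_group e G u ->
  exists g : {perm T}, [/\ g \in G, g u = u & {in neighbours e u, x =1 g}].
Proof.
case/morphimP=> g Ng /setIP[Gg /astab1P gu] ->.
by exists g; split=> // v Nv; rewrite restr_permE.
Qed.

Lemma local_restriction G u g (sGA : G \subset graph_aut e) :
    g \in G -> g u = u ->
  exists2 x, x \in local_group e G u & {in neighbours e u, x =1 g}.
Proof.
move=> Gg gu; have Ng := aut_norm_neighbours sGA Gg gu.
exists (restr_perm (neighbours e u) g) => [|v Nv]; last exact: restr_permE.
by apply: mem_morphim => //; apply/setIP; split=> //; apply/astab1P.
Qed.

Lemma local_group_acts G u :
  [acts local_group e G u, on neighbours e u | 'P].
Proof.
apply/subsetP=> _ /morphimP[g _ _ ->]; apply/astabsP=> v.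
by rewrite /= apermE (perm_closed v (restr_perm_on _ g)).
Qed.

(** Links the orbits that define rank and 2-transitivity to the elements of [G]
    by which homogeneity is expressed. *)
Lemma local_orbitP G u v w v' w' (sGA : G \subset graph_aut e) :
    e u v -> e u w ->
  reflect (exists g : {perm T}, [/\ g \in G, g u = u, g v = v' & g w = w'])
    ([tuple v'; w'] \in orbit ('P * 2) (local_group e G u) [tuple v; w]).
Proof.
move=> uv uw; have [Nv Nw]: v \in neighbours e u /\ w \in neighbours e u.
  by rewrite !inE.
apply: (iffP orbitP) => [[x /(local_groupP)[g [Gg gu xg]]] | ].
  by rewrite /= n_act_pair !xg // => -[<- <-]; exists g.
case=> g [Gg gu <- <-]; have [x Xx xg] := local_restriction sGA Gg gu.
by exists x; rewrite //= n_act_pair !xg.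
Qed.

Lemma local_pair_class G u x t (sGA : G \subset graph_aut e) :
    x \in local_group e G u ->
    t \in [set t : 2.-tuple T | t \subset neighbours e u] ->
  pair_class (('P * 2)%act t x) = pair_class t.
Proof.
have [v [w ->]] := tuple2E t; rewrite inE pair_subset.
move=> /(local_groupP)[g [Gg _ xg]] /andP[Nv Nw].
by rewrite /= n_act_pair !pair_classE !xg // (inj_eq perm_inj) (autE sGA Gg).
Qed.

Lemma locally_homogeneousP G u (sGA : G \subset graph_aut e) :
  locally_homogeneous G u <->
  {in [set t : 2.-tuple T | t \subset neighbours e u] &, forall s t,
     pair_class s = pair_class t ->
     t \in orbit ('P * 2) (local_group e G u) s}.
Proof.
split=> [homG s t | homX v w v' w' uv uw uv' uw' eq_vw e_vw].
  have [[v [w ->]] [v' [w' ->]]] := (tuple2E s, tuple2E t).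
  rewrite !inE !pair_subset !inE => /andP[uv uw] /andP[uv' uw'] [eq_vw e_vw].
  by apply/local_orbitP => //; apply: homG.
apply/local_orbitP => //; apply: homX.
- by rewrite inE pair_subset !inE uv.
- by rewrite inE pair_subset !inE uv'.
by rewrite !pair_classE eq_vw e_vw.
Qed.

(** * The rank 3 case and the 2-transitive case *)

(** Equal and adjacent is the one combination that irreflexivity excludes; a
    triangle and an open pair realise the adjacent and the nonadjacent class
    of distinct neighbours. *)
Lemma three_pair_classes u (irr_e : irreflexive e) :
    in_triangle u -> open_pair u ->
  #|pair_class @: [set t : 2.-tuple T | t \subset neighbours e u]| = 3.
Proof.
case/in_triangleP=> v [w [uv uw vw]].
case/open_pairP=> v' [w' [uv' uw' nvw' nevw']].
have -> : pair_class @: [set t : 2.-tuple T | t \subset neighbours e u]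
    = ~: [set (true, true)].
  apply/setP=> -[b1 b2]; rewrite !inE; apply/imsetP/idP => [[t _] | ].
    have [x [y ->]] := tuple2E t; rewrite pair_classE => -[-> ->].
    by rewrite xpair_eqE !eqb_id; case: eqVneq => //= ->; rewrite irr_e.
  case: b1 b2 => [] [] // _.
  - exists [tuple v; v]; first by rewrite inE pair_subset !inE uv.
    by rewrite pair_classE eqxx irr_e.
  - exists [tuple v; w]; first by rewrite inE pair_subset !inE uv.
    by rewrite pair_classE vw; case: eqVneq vw => // ->; rewrite irr_e.
  - exists [tuple v'; w']; first by rewrite inE pair_subset !inE uv'.
    by rewrite pair_classE (negPf nvw') (negPf nevw').
by rewrite cardsCs setCK cards1 card_prod card_bool.
Qed.

(** The rank counts the orbits on pairs, and there are three classes to be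
    separated: with three orbits, no class can contain two of them. *)
Lemma rank3_locally_homogeneous G u (irr_e : irreflexive e)
    (sGA : G \subset graph_aut e) :
    in_triangle u -> open_pair u ->
  perm_rank (local_group e G u) (neighbours e u) = 3 <->
  locally_homogeneous G u.
Proof.
move=> tri_u open_u; have homP := locally_homogeneousP u sGA.
rewrite -(three_pair_classes irr_e tri_u open_u) /perm_rank.
split=> [/eqP rk | /homP hom]; last first.
  by apply/eqP/card_orbits_eqP => // x t; apply: local_pair_class.
by apply/homP/card_orbits_eqP => // x t; apply: local_pair_class.
Qed.

Lemma two_transitive_locally_homogeneous G u (sGA : G \subset graph_aut e) :
  two_transitive (local_group e G u) (neighbours e u) ->
  locally_homogeneous G u.
Proof.
move=> tr2; apply/locally_homogeneousP => // s t.
have [[v [w ->]] [v' [w' ->]]] := (tuple2E s, tuple2E t).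
rewrite !inE !pair_subset !pair_classE.
move=> /andP[Nv Nw] /andP[Nv' Nw'] [eq_vw e_vw].
case/orP: tr2 => [/card_le1_eqP N1 | tr2].
  by rewrite (N1 v v') // (N1 w w') // orbit_refl.
have [eq_v | neq_v] := eqVneq v w; last first.
  case: (@atransP2 _ _ _ _ _ tr2 [tuple v; w] [tuple v'; w']) => [||x Xx ->].
  - by rewrite dtuple2E neq_v Nv.
  - by rewrite dtuple2E -eq_vw neq_v Nv'.
  exact: mem_orbit.
move: eq_vw; rewrite eq_v eqxx => /esym/eqP <-.
have [x Xx ->] := atransP2 (ntransitive1 (ltn0Sn 1) tr2) Nw Nv'.
by apply/orbitP; exists x; rewrite //= n_act_pair.
Qed.

Lemma locally_homogeneous_transitive G u (irr_e : irreflexive e)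
    (sGA : G \subset graph_aut e) :
    locally_homogeneous G u -> neighbours e u != set0 ->
  [transitive local_group e G u, on neighbours e u | 'P].
Proof.
move=> homG N0; apply: acts_transitive => // [|v w].
  exact: local_group_acts.
rewrite !inE => uv uw.
have [||g [Gg gu gv _]] := homG v v w w uv uv uw uw; rewrite ?eqxx ?irr_e //.
have [x Xx xg] := local_restriction sGA Gg gu.
by apply/orbitP; exists x; rewrite //= apermE xg ?inE.
Qed.

(** Without a triangle or without an open pair at [u], adjacency does not
    distinguish between pairs of distinct neighbours, so homogeneity puts no
    condition on which of them are carried to each other. *)
Lemma locally_homogeneous_two_transitive G u (sGA : G \subset graph_aut e) :
    locally_homogeneous G u -> ~~ (in_triangle u && open_pair u) ->
  two_transitive (local_group e G u) (neighbours e u).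
Proof.
move=> homG one_class.
rewrite /two_transitive; have [//|gt1] := leqP #|neighbours e u| 1.
have [v [w [Nv Nw neq_vw]]] := card_gt1P gt1.
have actX : [acts local_group e G u, on 2.-dtuple(neighbours e u) | 'P * 2].
  apply/actsP=> x Xx t; have [v1 [w1 ->]] := tuple2E t.
  have Nx y := actsP (local_group_acts G u) x Xx y.
  by rewrite /= n_act_pair !dtuple2E (inj_eq perm_inj) -!apermE !Nx.
apply: acts_transitive => //.
  by apply/set0Pn; exists [tuple v; w]; rewrite dtuple2E neq_vw Nv.
move=> s t; have [[v1 [w1 ->]] [v2 [w2 ->]]] := (tuple2E s, tuple2E t).
rewrite !dtuple2E !inE => /and3P[neq1 uv1 uw1] /and3P[neq2 uv2 uw2].
apply/local_orbitP=> //; apply: homG => //.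
  by rewrite (negPf neq1) (negPf neq2).
apply/idP/idP=> [e1 | e2]; apply/idPn=> ne; case/negP: one_class; apply/andP.
all: split.
- by apply/in_triangleP; exists v1, w1.
- by apply/open_pairP; exists v2, w2.
- by apply/in_triangleP; exists v2, w2.
by apply/open_pairP; exists v1, w1.
Qed.

(** * Small connected subgraphs *)

(** Along a path from [x], adjacency to [x] propagates: [x] and the next vertex
    are both neighbours of the current one. *)
Lemma clique_neighbours_complete (sym_e : symmetric e)
    (e_connected : connected_graph e) :
  (forall u, ~~ open_pair u) -> complete_graph e.
Proof.
move=> clique x y neq_xy.
have /connectP[p] := e_connected x y.
elim/last_ind: p y neq_xy => [|p z IHp] y neq_xy /=.
  by move=> _ yx; rewrite yx eqxx in neq_xy.
rewrite rcons_path last_rcons => /andP[path_p pz] y_z; subst z.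
have [eq_x | neq_x] := eqVneq x (last x p); first by rewrite eq_x.
have xp := IHp _ neq_x path_p erefl; apply/idPn=> nexy.
by case/open_pairP: (clique (last x p)); exists x, y; rewrite sym_e.
Qed.

Lemma connected_in_star A u (sym_e : symmetric e) :
    u \in A -> {in A, forall v, v != u -> e u v} -> connected_in e A.
Proof.
move=> Au star; split=> [|v w Av Aw]; first by apply/set0Pn; exists u.
have to_u x : x \in A -> connect (induced e A) u x.
  move=> Ax; have [-> | neq_xu] := eqVneq x u; first exact: connect0.
  by apply: connect1; rewrite /induced /= Au Ax star.
have sym_ind : symmetric (induced e A).
  by move=> x y; rewrite /induced /= sym_e andbCA; do !bool_congr.
by apply: connect_trans (to_u w Aw); rewrite (sym_connect_sym sym_ind) to_u.
Qed.

Lemma connected_in_neighbour A u :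
    connected_in e A -> u \in A -> A != [set u] ->
  exists2 v, v \in A & e u v.
Proof.
case=> _ connA Au neqA.
have [w Aw neq_wu] : exists2 w, w \in A & w != u.
  apply/exists_inP; apply: contraNT neqA => /exists_inPn all_u.
  rewrite eqEsubset sub1set Au andbT; apply/subsetP=> w /all_u.
  by rewrite negbK inE.
have /connectP[[|v p] /=] := connA u w Au Aw.
  by move=> _ wu; rewrite wu eqxx in neq_wu.
by case/andP=> /and3P[_ Av uv] _ _; exists v.
Qed.

(** The vertices [v] and [w] may coincide, which makes an edge a special case of
    the centred triple. *)
Lemma connected_in_le3 A (e_simple : simple_graph e) :
    connected_in e A -> #|A| <= 3 ->
  (exists u, A = [set u]) \/
  exists u v w, [/\ A = [set u; v; w], e u v & e u w].
Proof.
case: e_simple => sym_e irr_e connA leA3.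
have /set0Pn[x Ax] := connA.1.
have [-> | neqA] := eqVneq A [set x]; [by left; exists x | right].
have [y Ay xy] := connected_in_neighbour connA Ax neqA.
have neq_xy : x != y by apply: contraTneq xy => ->; rewrite irr_e.
have [sA2 | /subsetPn[z Az]] := boolP (A \subset [set x; y]).
  exists x, y, y; split=> //; apply/eqP; rewrite eqEsubset -setUA setUid sA2.
  by rewrite subUset !sub1set Ax.
rewrite !inE negb_or => /andP[neq_zx neq_zy].
have defA : A = [set x; y; z].
  apply/eqP; rewrite eq_sym eqEcard !subUset !sub1set Ax Ay Az /=.
  by rewrite setUC cardsU1 cards2 !inE negb_or neq_zx neq_zy neq_xy.
have [|t At zt] := connected_in_neighbour connA Az.
  by apply: contraNneq neq_zx => defz; rewrite defz inE eq_sym in Ax.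
(* The centre is whichever of [x] and [y] is adjacent to the third vertex. *)
move: At zt; rewrite {1}defA !inE -orbA => /or3P[] /eqP-> zt.
- by exists x, y, z; split=> //; rewrite sym_e.
- by exists y, x, z; split; rewrite 1?sym_e // defA (setUC [set x]).
by rewrite irr_e in zt.
Qed.

(** * 3-CH graphs and local homogeneity *)

Lemma CH3_transitive G u (irr_e : irreflexive e) :
  connected_homogeneous e G 3 -> [transitive G, on [set: T] | 'P].
Proof.
move=> CH; apply: acts_transitive => [||x y _ _].
- by apply/actsP=> g _ x; rewrite !inE.
- by apply/set0Pn; exists u.
have single z : connected_in e [set z].
  split=> [|v w]; first by apply/set0Pn; exists z; rewrite inE.
  by rewrite !inE => /eqP-> /eqP->; apply: connect0.
have [||g Gg fg] := CH [set x] [set y] (fun=> y) (single x) (single y).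
  by rewrite cards1.
  split; first exact: imset_set1.
    by move=> v w; rewrite !inE => /eqP-> /eqP->.
  by move=> v w; rewrite !inE => /eqP-> /eqP->; rewrite !irr_e.
by apply/orbitP; exists g; rewrite //= apermE -fg ?inE.
Qed.

(** The map that fixes [u] and sends [v], [w] to [v'], [w'] is an isomorphism
    between two connected subgraphs centred at [u]. *)
Lemma CH3_locally_homogeneous G u (e_simple : simple_graph e) :
  connected_homogeneous e G 3 -> locally_homogeneous G u.
Proof.
have [sym_e irr_e] := e_simple; move=> CH v w v' w' uv uw uv' uw' eq_vw e_vw.
have neq_u x : e u x -> (x == u) = false.
  by move=> ux; apply: contraTF ux => /eqP->; rewrite irr_e.
have star x y : e u x -> e u y -> connected_in e [set u; x; y].
  move=> ux uy; apply: (connected_in_star (u := u)) => //.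
    by rewrite !inE eqxx.
  by move=> z; rewrite !inE -orbA => /or3P[] /eqP-> //; rewrite eqxx.
pose f x := if x == u then u else if x == v then v' else w'.
have fu : f u = u by rewrite /f eqxx.
have fv : f v = v' by rewrite /f neq_u // eqxx.
have fw : f w = w'.
  rewrite /f neq_u //; case: eqVneq => // wv.
  by apply/eqP; rewrite -eq_vw wv.
have [||||g Gg fg] := CH [set u; v; w] [set u; v'; w'] f.
- exact: star.
- exact: star.
- by rewrite -setUA !cardsU1 cards1; do 2!case: (_ \notin _).
- split; first by rewrite !imsetU !imset_set1 fu fv fw.
    suffices f_eq : {in [set u; v; w] &, forall x y, (f x == f y) = (x == y)}.
      by move=> x y Ax Ay /eqP; rewrite f_eq // => /eqP.
    have neq_u' x : e u x -> (u == x) = false by rewrite eq_sym; apply: neq_u.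
    move=> x y; rewrite !inE -!orbA.
    do 2![case/or3P=> /eqP->]; rewrite ?fu ?fv ?fw ?eqxx ?neq_u ?neq_u' //.
    by rewrite ![w' == _]eq_sym ![w == _]eq_sym.
  have e_to_u x : e u x -> e x u by rewrite sym_e.
  move=> x y; rewrite !inE -!orbA.
  do 2![case/or3P=> /eqP->];
    rewrite ?fu ?fv ?fw ?irr_e ?uv ?uw ?uv' ?uw' ?e_to_u //.
  by rewrite ![e w' _]sym_e ![e w _]sym_e.
by exists g; split; rewrite // -fg ?inE ?eqxx ?orbT.
Qed.

Lemma locally_homogeneous_translate G u u' (sGA : G \subset graph_aut e) :
    [transitive G, on [set: T] | 'P] ->
  locally_homogeneous G u -> locally_homogeneous G u'.
Proof.
move=> trG homG v w v' w' uv uw uv' uw' eq_vw e_vw.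
have [h Gh /= hu] := atransP2 trG (in_setT u') (in_setT u).
have mono_h := autE sGA Gh.
have uh x : e u' x -> e u (h x) by rewrite hu mono_h.
have [||||||g [Gg gu gv gw]] := homG (h v) (h w) (h v') (h w').
all: rewrite ?(inj_eq perm_inj) ?mono_h ?uh //.
exists (h * g * h^-1)%g; rewrite !groupM ?groupV //.
by rewrite !permM gv gw -[h u']hu gu hu !permK.
Qed.

(** Having moved the centre [x] to [f x] by some [g], it remains to carry the
    neighbours [g v], [g w] of [f x] to [f v], [f w]; these two pairs are in the
    same class because [f] and [g] both preserve equality and adjacency. *)
Lemma locally_homogeneous_CH3 G u (e_simple : simple_graph e)
    (sGA : G \subset graph_aut e) :
    [transitive G, on [set: T] | 'P] -> locally_homogeneous G u ->
  connected_homogeneous e G 3.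
Proof.
move=> trG hom_u A B f connA _ leA3 [_ inj_f mono_f].
have move_to x : exists2 g : {perm T}, g \in G & f x = g x.
  have [g Gg fx] := atransP2 trG (in_setT x) (in_setT (f x)).
  by exists g; rewrite // -apermE.
have [[x defA] | [x [v [w [defA xv xw]]]]] :=
    connected_in_le3 e_simple connA leA3.
  have [g Gg fx] := move_to x; exists g => // y.
  by rewrite defA inE => /eqP->.
have [g Gg fx] := move_to x; have mono_g := autE sGA Gg.
have [Ax Av Aw] : [/\ x \in A, v \in A & w \in A].
  by rewrite defA !inE !eqxx !orbT.
have hom_fx := locally_homogeneous_translate (u' := f x) sGA trG hom_u.
have [||||||h [Gh hx hv hw]] := hom_fx (g v) (g w) (f v) (f w).
all: rewrite ?mono_f ?(inj_eq perm_inj) ?(inj_in_eq inj_f) ?mono_g //.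
- by rewrite fx mono_g.
- by rewrite fx mono_g.
exists (g * h)%g => [|y]; first exact: groupM.
rewrite defA !inE permM -orbA.
by case/or3P=> /eqP->; rewrite -?fx ?hx ?hv ?hw.
Qed.

(** * Girth and completeness seen at one vertex *)

Lemma open_pair_aut G u g (sGA : G \subset graph_aut e) :
  g \in G -> open_pair u -> open_pair (g u).
Proof.
move=> Gg /open_pairP[v [w [uv uw neq_vw nevw]]]; apply/open_pairP.
by exists (g v), (g w); rewrite (inj_eq perm_inj) !(autE sGA Gg).
Qed.

Lemma incomplete_open_pair G u (sym_e : symmetric e)
    (e_connected : connected_graph e) (sGA : G \subset graph_aut e) :
    [transitive G, on [set: T] | 'P] -> ~ complete_graph e -> open_pair u.
Proof.
move=> trG incomplete; apply: contra_notT incomplete => closed_u.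
apply: clique_neighbours_complete => // v; apply: contra closed_u.
have [g Gg ->] := atransP2 trG (in_setT v) (in_setT u).
exact: open_pair_aut sGA Gg.
Qed.

Lemma girth3_triangle G u (sym_e : symmetric e)
    (sGA : G \subset graph_aut e) :
    [transitive G, on [set: T] | 'P] -> has_girth e 3 -> in_triangle u.
Proof.
move=> trG [[[|a [|b [|c [|? ?]]]] //]].
case/andP=> _ /andP[/= /and4P[ab bc ca _] _] _ _.
have [g Gg ->] := atransP2 trG (in_setT a) (in_setT u).
apply/in_triangleP; exists (g b), (g c).
by rewrite /= apermE !(autE sGA Gg) ab bc sym_e ca.
Qed.

Lemma triangle_girth3 u (e_simple : simple_graph e) :
  in_triangle u -> has_girth e 3.
Proof.
case: e_simple => sym_e irr_e /in_triangleP[v [w [uv uw vw]]].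
have neq x y : e x y -> x == y = false.
  by apply: contraTF => /eqP->; rewrite irr_e.
split=> [|c /andP[]//]; exists [:: u; v; w] => //.
by rewrite /graph_cycle /ucycleb /= !inE uv vw sym_e uw !neq.
Qed.

Lemma open_pair_incomplete u : open_pair u -> ~ complete_graph e.
Proof. by case/open_pairP=> v [w [_ _ neq_vw /negP nevw]] /(_ v w neq_vw). Qed.

End Graphs.

Theorem proposition1p2 (T : finType) (e : rel T) (G : {group {perm T}}) (u : T)
    (e_simple : simple_graph e) (e_connected : connected_graph e)
    (sGAut : G \subset graph_aut e) :
  connected_homogeneous e G 3 <->
  [transitive G, on [set: T] | 'P] /\
  (two_transitive (local_group e G u) (neighbours e u) \/
   [/\ transitive_of_rank (local_group e G u) (neighbours e u) 3,
       has_girth e 3 & ~ complete_graph e]).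
Proof.
have [sym_e irr_e] := e_simple; split=> [CH | [trG local_cond]].
  have homG := CH3_locally_homogeneous (u := u) e_simple CH.
  split; first exact: CH3_transitive u irr_e CH.
  have [/andP[tri_u open_u] | one_class] :=
    boolP (in_triangle e u && open_pair e u); last first.
    by left; apply: locally_homogeneous_two_transitive.
  right; split; last exact: open_pair_incomplete open_u.
    apply/andP; split; last by apply/eqP/rank3_locally_homogeneous.
    apply: locally_homogeneous_transitive => //.
    have /in_triangleP[v [_ [uv _ _]]] := tri_u.
    by apply/set0Pn; exists v; rewrite inE.
  exact: triangle_girth3 tri_u.
apply: (locally_homogeneous_CH3 (u := u)) => //.
case: local_cond => [tr2 | [/andP[_ /eqP rank3] girth3 incomplete]].
  exact: two_transitive_locally_homogeneous.
apply/rank3_locally_homogeneous => //; first exact: girth3_triangle trG girth3.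
exact: incomplete_open_pair trG incomplete.
Qed.
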